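(* If $\mathfrak F\in\mathsf{LBWE}$, then for every formula $\varphi$, the formula $\mathsf E\varphi\leftrightarrow(\langle B\rangle(\varphi,\top)\vee\varphi)$ is valid on $\mathfrak F$.
   Context: A 3-frame is $\langle W,B\rangle$, $B\subseteq W^3$; $\#(x,y,z)$ means pairwise distinct. $\mathsf{LBWE}$: 3-frames satisfying (B1) $B(x,y,z)\to\#(x,y,z)$; (B2) $B(x,y,z)\to B(z,y,x)$; (B3) $B(x,y,z)\to\neg B(x,z,y)$; (B4) $B(x,y,z)\wedge B(y,z,u)\to B(x,y,u)$; (B5) $B(x,y,z)\wedge B(y,u,z)\to B(x,y,u)$; (B6) $\#(x,y,z)\to B(x,y,z)\vee B(x,z,y)\vee B(y,x,z)$; (B7) $\forall y\exists x\exists z\,B(x,y,z)$. Formulas are those of the hybrid language with $\top$, propositional variables, nominals, $\neg,\wedge$, the binary modality $\langle B\rangle$, satisfaction operators $@_i$ and the existential modality $\mathsf E$. Valuations map variables to subsets and nominals to singletons; $w\Vdash\langle B\rangle(\varphi,\psi)$ iff there are $x,y$ with $x\Vdash\varphi$, $y\Vdash\psi$ and $B(x,w,y)$; $w\Vdash @_i\varphi$ iff the element of $V(i)$ satisfies $\varphi$; $w\Vdash\mathsf E\varphi$ iff some point of $W$ satisfies $\varphi$. *)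

(* Defs.v *)
Set Implicit Arguments.
Unset Strict Implicit.

Record frame3 : Type := Frame3 {
  point : Type;
  betw : point -> point -> point -> Prop
}.

Definition distinct3 (T : Type) (x y z : T) : Prop :=
  x <> y /\ x <> z /\ y <> z.

Record LBWE (F : frame3) : Prop := {
  LBWE_B1 : forall x y z : point F, betw x y z -> distinct3 x y z;
  LBWE_B2 : forall x y z : point F, betw x y z -> betw z y x;
  LBWE_B3 : forall x y z : point F, betw x y z -> ~ betw x z y;
  LBWE_B4 : forall x y z u : point F,
    betw x y z /\ betw y z u -> betw x y u;
  LBWE_B5 : forall x y z u : point F,
    betw x y z /\ betw y u z -> betw x y u;
  LBWE_B6 : forall x y z : point F,
    distinct3 x y z -> betw x y z \/ betw x z y \/ betw y x z;
  LBWE_B7 : forall y : point F, exists x z : point F, betw x y z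
}.

Inductive formula (PV NOM : Type) : Type :=
| FTop : formula PV NOM
| FVar : PV -> formula PV NOM
| FNom : NOM -> formula PV NOM
| FNeg : formula PV NOM -> formula PV NOM
| FAnd : formula PV NOM -> formula PV NOM -> formula PV NOM
| FB : formula PV NOM -> formula PV NOM -> formula PV NOM
| FAt : NOM -> formula PV NOM -> formula PV NOM
| FE : formula PV NOM -> formula PV NOM.

Arguments FTop {PV NOM}.
Arguments FVar {PV NOM} _.
Arguments FNom {PV NOM} _.

Definition FOr (PV NOM : Type) (phi psi : formula PV NOM) : formula PV NOM :=
  FNeg (FAnd (FNeg phi) (FNeg psi)).

Definition FImp (PV NOM : Type) (phi psi : formula PV NOM) : formula PV NOM :=
  FNeg (FAnd phi (FNeg psi)).

Definition FIff (PV NOM : Type) (phi psi : formula PV NOM) : formula PV NOM :=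
  FAnd (FImp phi psi) (FImp psi phi).

Record valuation (PV NOM W : Type) : Type := Valuation {
  val_var : PV -> W -> Prop;
  val_nom : NOM -> W -> Prop;
  val_nom_singleton : forall i : NOM, exists! w : W, val_nom i w
}.

Fixpoint sat (PV NOM : Type) (F : frame3) (V : valuation PV NOM (point F))
    (w : point F) (phi : formula PV NOM) {struct phi} : Prop :=
  match phi with
  | FTop => True
  | FVar p => val_var V p w
  | FNom i => val_nom V i w
  | FNeg psi => ~ sat V w psi
  | FAnd psi chi => sat V w psi /\ sat V w chi
  | FB psi chi =>
      exists x y : point F, sat V x psi /\ sat V y chi /\ betw x w y
  | FAt i psi => exists v : point F, val_nom V i v /\ sat V v psi
  | FE psi => exists v : point F, sat V v psi
  end.

Definition valid (PV NOM : Type) (F : frame3) (phi : formula PV NOM) : Prop :=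
  forall (V : valuation PV NOM (point F)) (w : point F), sat V w phi.

(* Main.v *)
From Stdlib Require Import Classical.
Require Import Defs.

(** The order has no endpoints, so a witness [v] of [phi] other than [w] can be continued through
    [w] to some [y]; then [v] and [y] witness [FB phi FTop] at [w]. If [v = w], the disjunct [phi]
    holds. *)

(* With a, b on either side of w given by (B7), the three relative positions of
   v, w, a allowed by (B6) each put w between v and a or between v and b. *)
Lemma LBWE_extend (F : frame3) (HF : LBWE F) (v w : point F) :
  v <> w -> exists y : point F, betw v w y.
Proof.
  intros Hvw.
  destruct (LBWE_B7 HF w) as [a [b Hawb]].
  destruct (classic (v = a)) as [-> | Hva]; [now exists b |].
  destruct (LBWE_B1 HF Hawb) as [Haw _].
  pose proof (LBWE_B2 HF Hawb) as Hbwa.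
  destruct (LBWE_B6 HF (x := v) (y := w) (z := a)) as [Hvwa | [Hvaw | Hwva]].
  - repeat split; congruence.
  - now exists a.
  (* Seen from [b], the points lie in the order [b], [w], [a], [v]. *)
  - exists b. apply (LBWE_B2 HF), (LBWE_B4 HF (z := a)).
    split; [assumption | now apply (LBWE_B2 HF)].
  (* Here the order is [b], [w], [v], [a]. *)
  - exists b. apply (LBWE_B2 HF), (LBWE_B5 HF (z := a)).
    now split.
Qed.

Theorem theorem6p1 (PV NOM : Type) (F : frame3) (HF : LBWE F)
    (phi : formula PV NOM) :
  valid F (FIff (FE phi) (FOr (FB phi FTop) phi)).
Proof.
  intros V w; simpl; split.
  - intros [[v Hv] Hn]. apply Hn. intros [HnB Hnw].
    destruct (LBWE_extend F HF v w) as [y Hy].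
    (* [v = w] would make [phi] true at [w], against [Hnw]. *)
    + intros ->. contradiction.
    + apply HnB. now exists v, y.
  - intros [Hor HnE]. apply Hor. split.
    + intros [x [y [Hx _]]]. apply HnE. now exists x.
    + intros Hw. apply HnE. now exists w.
Qed.
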